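(* Let $A$ be a finite abelian group and $t\geq1$. The operators $$R_{\mathcal{O}}=\sum_{\mathbf{v}\in\mathcal{O}}\kappa_t(\mathbf{v})^{-1}u_{\mathbf{v}},\qquad\mathcal{O}\in\mathrm{Sp}(V_A)\backslash Z_t(A),$$ form an orthogonal basis of $\mathfrak{D}_t(A)$ for the Hilbert--Schmidt inner product. Consequently, $$\dim\mathfrak{D}_t(A)=|\mathrm{Sp}(V_A)\backslash Z_t(A)|.$$
   Context: **Setting.** $A$ is a finite abelian group, written additively; $\widehat{A}=\mathrm{Hom}(A,U(1))$; $V_A=A\oplus\widehat{A}$ (written additively). Put $\beta_A((a,\chi),(b,\psi))=\chi(b)$ and $\omega_A(u,v)=\beta_A(u,v)\beta_A(v,u)^{-1}$; $\mathrm{Sp}(V_A)=\{T\in\mathrm{Aut}(V_A):\omega_A(Tu,Tv)=\omega_A(u,v)\ \forall u,v\}$. **Weyl operators and Clifford group.** Let $\mathcal{H}=\mathbb{C}[A]$ with orthonormal basis $|b\rangle$, $b\in A$; for $v=(a,\chi)\in V_A$ let $u_v=W_v$ be the operator $W_v|b\rangle=\chi(b)|a+b\rangle$, so $u_vu_w=\beta_A(v,w)u_{v+w}$. $H(A)=\{zW_v:z\in U(1),v\in V_A\}$ and $C(A)=N_{U(\mathcal{H})}(H(A))/(U(1)\cdot I)$. For $g\in C(A)$ let $U_g$ be a unitary representative of $g$; conjugation by $U_g$ has the form $U_gu_vU_g^{-1}=\lambda(v)u_{Tv}$ with $T\in\mathrm{Sp}(V_A)$, $\lambda:V_A\to U(1)$.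 It is known that every $T\in\mathrm{Sp}(V_A)$ arises in this way. **Commutant.** $\mathfrak{D}_t(A)=\{X\in\mathrm{End}_{\mathbb{C}}(\mathcal{H}^{\otimes t}):XU_g^{\otimes t}=U_g^{\otimes t}X\text{ for every }g\in C(A)\}$; it does not depend on the choice of the $U_g$. The Hilbert--Schmidt inner product is $\langle X,Y\rangle=\mathrm{Tr}(X^\dagger Y)$. **Tuples.** $Z_t(A)=\{(v_1,\dots,v_t)\in V_A^t:v_1+\cdots+v_t=0\}$ with the diagonal $\mathrm{Sp}(V_A)$-action. For $\mathbf{v}=(v_1,\dots,v_t)\in V_A^t$: $\kappa_t(\mathbf{v})=\prod_{1\leq i<j\leq t}\beta_A(v_i,v_j)$ and $u_{\mathbf{v}}=u_{v_1}\otimes\cdots\otimes u_{v_t}\in\mathrm{End}_{\mathbb{C}}(\mathcal{H}^{\otimes t})$. *)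

(* Defs.v *)
From HB Require Import structures.
From mathcomp Require Import all_boot all_order all_fingroup all_algebra.
From mathcomp Require Import cyclic spectral sesquilinear.
From mathcomp Require Import boolp reals complex.

Set Implicit Arguments.
Unset Strict Implicit.
Unset Printing Implicit Defensive.

Import GRing.Theory Order.TTheory Num.Theory.
Local Open Scope ring_scope.
Local Open Scope sesquilinear_scope.

(* The scalars form a numClosedFieldType C; the theorem instantiates C with   *)
(* the complex numbers R[i] over a realType R.                                *)

(* Makes products of finZmodTypes canonically finZmodTypes. *)
HB.saturate prod.

Section Character.
Variables (C : numClosedFieldType) (A : finZmodType).

Definition is_character (f : {ffun A -> C}) : bool :=
  [forall a, `|f a| == 1] && [forall a, forall b, f (a + b) == f a * f b].

Record character := Character {
  char_fun :> {ffun A -> C};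
  char_funP : is_character char_fun }.

HB.instance Definition _ := [isSub for char_fun].
HB.instance Definition _ := [Choice of character by <:].

Implicit Types chi psi : character.

Lemma charP chi psi : (forall a, chi a = psi a) -> chi = psi.
Proof. by move=> h; apply/val_inj/ffunP. Qed.

Lemma norm_char chi a : `|chi a| = 1.
Proof. by case: chi => f /= /andP[/forallP/(_ a)/eqP]. Qed.

Lemma charD chi a b : chi (a + b) = chi a * chi b.
Proof. by case: chi => f /= /andP[_ /forallP/(_ a)/forallP/(_ b)/eqP]. Qed.

Lemma char_neq0 chi a : chi a != 0.
Proof. by rewrite -normr_eq0 norm_char oner_eq0. Qed.

Lemma char0 chi : chi 0 = 1.
Proof. by apply: (mulfI (char_neq0 chi 0)); rewrite -charD addr0 mulr1. Qed.

Lemma charMn chi a n : chi (a *+ n) = chi a ^+ n.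
Proof. by elim: n => [|n IH]; rewrite ?char0 // mulrS charD IH exprS. Qed.

(* The values of characters are #|A|-th roots of unity, so that there are     *)
(* finitely many characters.                                                  *)
Let root_seq : seq C := sval (closed_field_poly_normal ('X^#|A| - 1%:P)).

Lemma char_root_seq chi a : chi a \in root_seq.
Proof.
have n0 : (0 < #|A|)%N by apply/card_gt0P; exists 0.
have : root ('X^#|A| - 1%:P) (chi a).
  rewrite rootE !hornerE -charMn.
  have -> : a *+ #|A| = 0.
    have := expg_cardG (in_setT (a : A)).
    by rewrite cardsT FinRing.zmodXgE.
  by rewrite char0 subrr.
rewrite /root_seq; case: closed_field_poly_normal => r /= ->.
by rewrite lead_coefXnsubC // scale1r root_prod_XsubC.
Qed.

Definition char_code chi : {ffun A -> seq_sub root_seq} :=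
  [ffun a => SeqSub (char_root_seq chi a)].
Definition char_decode (f : {ffun A -> seq_sub root_seq}) : option character :=
  insub [ffun a => val (f a)].

Lemma char_codeK : pcancel char_code char_decode.
Proof.
move=> chi; rewrite /char_decode.
have -> : [ffun a => val (char_code chi a)] = val chi.
  by apply/ffunP=> a; rewrite !ffunE.
exact: valK.
Qed.

HB.instance Definition _ := PCanIsCountable char_codeK.
HB.instance Definition _ : isFinite character := PCanIsFinite char_codeK.

Fact char_zero_subproof : is_character [ffun=> 1].
Proof.
apply/andP; split; apply/forallP=> a; first by rewrite ffunE normr1.
by apply/forallP=> b; rewrite !ffunE mulr1.
Qed.
Definition char_zero := Character char_zero_subproof.

Fact char_opp_subproof chi : is_character [ffun a => (chi a)^-1].
Proof.
apply/andP; split; apply/forallP=> a.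
  by rewrite ffunE normfV norm_char invr1.
by apply/forallP=> b; rewrite !ffunE charD invfM.
Qed.
Definition char_opp chi := Character (char_opp_subproof chi).

Fact char_add_subproof chi psi : is_character [ffun a => chi a * psi a].
Proof.
apply/andP; split; apply/forallP=> a.
  by rewrite ffunE normrM !norm_char mulr1.
by apply/forallP=> b; rewrite !ffunE !charD mulrACA.
Qed.
Definition char_add chi psi := Character (char_add_subproof chi psi).

Fact char_addA : associative char_add.
Proof. by move=> x y z; apply: charP => a; rewrite !ffunE mulrA. Qed.
Fact char_addC : commutative char_add.
Proof. by move=> x y; apply: charP => a; rewrite !ffunE mulrC. Qed.
Fact char_add0 : left_id char_zero char_add.
Proof. by move=> x; apply: charP => a; rewrite !ffunE mul1r. Qed.
Fact char_addN : left_inverse char_zero char_opp char_add.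
Proof. by move=> x; apply: charP => a; rewrite !ffunE mulVf // char_neq0. Qed.

HB.instance Definition _ :=
  GRing.isZmodule.Build character char_addA char_addC char_add0 char_addN.

Definition phase_space : finZmodType := (A * character)%type.

Definition beta (u v : phase_space) : C := u.2 v.1.

Definition omega (u v : phase_space) : C := beta u v * (beta v u)^-1.

(* [Aut [set: V]] is the automorphism group of the additive group V, a set of *)
(* permutations of V.                                                         *)
Definition Sp : {set {perm phase_space}} :=
  [set T in Aut [set: phase_space] |
    [forall u, forall v, omega (T u) (T v) == omega u v]].

End Character.

(* Operators on the Hilbert space with orthonormal basis |i>, i in I, are     *)
(* matrices in this basis, ordered by [enum_rank].                            *)
Definition op (C : numClosedFieldType) (I : finType) := 'M[C]_#|I|.

Definition op_of (C : numClosedFieldType) (I : finType) (f : I -> I -> C) :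
    op C I :=
  \matrix_(i, j) f (enum_val i) (enum_val j).

Definition entry (C : numClosedFieldType) (I : finType) (X : op C I) (a b : I) :
    C :=
  X (enum_rank a) (enum_rank b).

(* |b_1> (x) ... (x) |b_t> is identified with the basis vector indexed by the *)
(* family b, so that the t-th tensor power of C[A] is C[A^t].                 *)
Definition tensor (C : numClosedFieldType) (I : finType) (t : nat)
    (X : 'I_t -> op C I) : op C {ffun 'I_t -> I} :=
  op_of (fun a b : {ffun 'I_t -> I} => \prod_(k < t) entry (X k) (a k) (b k)).

Definition tensor_pow (C : numClosedFieldType) (I : finType) (t : nat)
    (X : op C I) : op C {ffun 'I_t -> I} :=
  tensor (fun _ => X).

Definition hilbert_schmidt (C : numClosedFieldType) (I : finType)
    (X Y : op C I) : C :=
  \tr (X ^t* *m Y).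

(* [subspace_of P] is the subspace with carrier P when P is linearly closed;  *)
(* it takes an arbitrary value otherwise.                                     *)
Section SubspaceOf.
Variables (K : fieldType) (V : vectType K) (P : V -> Prop).

Definition linearly_closed : Prop :=
  P 0 /\ forall (k : K) (u v : V), P u -> P v -> P (k *: u + v).

Lemma subspace_of_ex :
  exists U : {vspace V}, linearly_closed -> forall v, v \in U <-> P v.
Proof.
have [[P0 Plin]|nP] := pselect linearly_closed; last by exists 0%VS.
pose Q (n : nat) :=
  `[< exists2 U : {vspace V}, \dim U = n & forall v, v \in U -> P v >].
have exQ : exists n, Q n.
  exists 0%N; apply/asboolP; exists 0%VS; first exact: dimv0.
  by move=> v; rewrite memv0 => /eqP->.
have ubQ n : Q n -> (n <= \dim {:V})%N.
  by move=> /asboolP[U <- _]; apply/dimvS/subvf.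
case: (ex_maxnP exQ ubQ) => _ /asboolP[U <- UP] Umax.
exists U => _ v; split=> [/UP//|Pv]; apply: contrapT => /negP nUv.
have: Q (\dim (<[v]> + U)%VS).
  apply/asboolP; exists (<[v]> + U)%VS => // w /memv_addP[x /vlineP[k ->]].
  by move=> [u Uu ->]; apply: Plin => //; apply: UP.
move=> /Umax; rewrite leqNgt => /negP; apply.
rewrite (ltn_leqif (dimv_leqif_sup (addvSr _ _))).
apply: contra nUv => /subvP; apply.
exact: subvP (addvSl _ _) _ (memv_line v).
Qed.

Definition subspace_of : {vspace V} := projT1 (cid subspace_of_ex).

Lemma mem_subspace_of v : linearly_closed -> v \in subspace_of <-> P v.
Proof. by rewrite /subspace_of; case: cid => U /= h /h. Qed.

End SubspaceOf.

Section Clifford.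
Variables (C : numClosedFieldType) (A : finZmodType).

Local Notation V := (phase_space C A).

Definition weyl (v : V) : op C A :=
  op_of (fun a b => if a == v.1 + b then v.2 b else 0).

Definition heisenberg (M : op C A) : Prop :=
  exists z : C, exists v : V, `|z| = 1 /\ M = z *: weyl v.

Definition normalizes_heisenberg (U : op C A) : Prop :=
  U \is unitarymx /\
  forall M, heisenberg M <->
    exists N, heisenberg N /\ M = U *m N *m invmx U.

(* Elements of C(A) are classes U(1)U, viewed as predicates on operators.     *)
Definition clifford (g : op C A -> Prop) : Prop :=
  exists U, normalizes_heisenberg U /\
    forall M, g M <-> exists z : C, `|z| = 1 /\ M = z *: U.

Variable t : nat.

(* The condition does not depend on the representative U of g, so it may be   *)
(* required for all of them.                                                  *)
Definition in_commutant (X : op C {ffun 'I_t -> A}) : Prop :=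
  forall g, clifford g -> forall U, g U ->
    X *m tensor_pow t U = tensor_pow t U *m X.

Lemma in_commutant_linear :
  linearly_closed (V := 'M[C]_#|{ffun 'I_t -> A}|) in_commutant.
Proof.
split=> [g _ U _|k X Y hX hY g hg U gU]; first by rewrite mul0mx mulmx0.
by rewrite mulmxDl mulmxDr -scalemxAl -scalemxAr (hX g) ?(hY g).
Qed.

Definition commutant : {vspace 'M[C]_#|{ffun 'I_t -> A}|} :=
  subspace_of in_commutant.

Lemma mem_commutant X : X \in commutant <-> in_commutant X.
Proof. exact: mem_subspace_of in_commutant_linear. Qed.

Local Notation tuples := {ffun 'I_t -> V}.

Definition zero_sum : {set tuples} := [set v : tuples | \sum_i v i == 0].

Definition diag_act (v : tuples) (T : {perm V}) : tuples :=
  [ffun i => T (v i)].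

Fact diag_act1 : diag_act^~ 1%g =1 id.
Proof. by move=> v; apply/ffunP=> i; rewrite ffunE perm1. Qed.
Fact diag_actM v : act_morph diag_act v.
Proof. by move=> S T; apply/ffunP=> i; rewrite !ffunE permM. Qed.
Definition diag_action := TotalAction diag_act1 diag_actM.

Definition Sp_orbits : {set {set tuples}} :=
  [set orbit diag_action (Sp C A) v | v in zero_sum].

Definition kappa (v : tuples) : C :=
  \prod_(i < t) \prod_(j < t | (i < j)%N) beta (v i) (v j).

Definition weyl_tuple (v : tuples) : op C {ffun 'I_t -> A} :=
  tensor (fun i => weyl (v i)).

Definition orbit_op (o : {set tuples}) : 'M[C]_#|{ffun 'I_t -> A}| :=
  \sum_(v in o) (kappa v)^-1 *: weyl_tuple v.

End Clifford.

(* Main.v *)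
Require Import Defs.
From mathcomp Require Import all_boot all_order all_fingroup all_algebra.
From mathcomp Require Import cyclic.
From mathcomp Require Import boolp reals complex ring.

Set Implicit Arguments.
Unset Strict Implicit.
Unset Printing Implicit Defensive.

Import GRing.Theory Order.TTheory Num.Theory.
Local Open Scope ring_scope.
Local Open Scope sesquilinear_scope.

(** Write u_v for the tensor product of Weyl operators attached to a tuple v of
    phase space vectors.  Characters separate the points of A
    ([char_separates]), so the u_v form an orthogonal basis of the operators on
    the tensor power ([hilbert_schmidt_weyl_tuple], [weyl_tuple_expansion]).

    A Clifford unitary U satisfies U u_v = lam(v) u_(Tv) U on single vectors,
    for a symplectic T and phases lam ([normalizes_implements]).  Evaluating
    U u_v u_w in two ways gives
      beta(v, w) lam(v + w) = lam(v) lam(w) beta(Tv, Tw),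
    so that lam trivialises the difference of the cocycles beta and beta o T.
    Multiplying along a tuple of sum 0, the product of the phases is
    kappa(v) / kappa(Tv) ([kappa_diag_act]): conjugation by the tensor power of
    U permutes the rescaled operators kappa(v)^-1 u_v exactly, without phases.
    The orbit sums are therefore in the commutant.

    Conversely, expand X of the commutant in the u_v.  The Weyl operators are
    themselves Clifford, with T = 1 and lam = omega(w, -); since omega is
    nondegenerate, the coefficients of X vanish off the tuples of sum 0
    ([coef_outside_zero_sum]).  On these, the rescaled coefficients of X are
    constant along the orbits ([coef_Sp_invariant]), because every symplectic T
    is realised by some U ([Sp_implemented]).  So X is a combination of the
    orbit sums, which are orthogonal because distinct orbits involve disjoint
    sets of the u_v. *)

(** * Operators through their entries *)

Lemma adjointM (C : numClosedFieldType) m n p (X : 'M[C]_(m, n))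
    (Y : 'M[C]_(n, p)) :
  (X *m Y)^t* = Y^t* *m X^t*.
Proof. by rewrite trmx_mul map_mxM. Qed.

Lemma adjointZ (C : numClosedFieldType) m n (c : C) (X : 'M[C]_(m, n)) :
  (c *: X)^t* = c^* *: X^t*.
Proof. by rewrite linearZ map_mxZ. Qed.

Lemma ffun_neq (J : finType) (I : eqType) (f g : {ffun J -> I}) :
  f != g -> exists j, f j != g j.
Proof.
move=> neq; apply/existsP; apply: contra_neqT neq => /existsPn eqfg.
by apply/ffunP=> j; apply/eqP; rewrite -[_ == _]negbK.
Qed.

Section Operators.
Variables (C : numClosedFieldType) (I : finType).
Implicit Types (X Y : op C I) (a b : I).

Lemma entry_op_of (f : I -> I -> C) a b : entry (op_of f) a b = f a b.
Proof. by rewrite /entry mxE !enum_rankK. Qed.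

Lemma opP X Y : (forall a b, entry X a b = entry Y a b) -> X = Y.
Proof.
move=> eqXY; apply/matrixP=> i j.
by have := eqXY (enum_val i) (enum_val j); rewrite /entry !enum_valK.
Qed.

Lemma sum_ord_enum_rank (F : 'I_#|I| -> C) :
  \sum_i F i = \sum_(a : I) F (enum_rank a).
Proof.
rewrite [RHS](reindex (@enum_val I I)) /=; last first.
  by exists enum_rank => i _; rewrite (enum_valK, enum_rankK).
by apply: eq_bigr => i _; rewrite enum_valK.
Qed.

Lemma entryM X Y a b : entry (X *m Y) a b = \sum_c entry X a c * entry Y c b.
Proof. by rewrite /entry mxE sum_ord_enum_rank. Qed.

Lemma entry_adj X a b : entry (X^t* : op C I) a b = (entry X b a)^*.
Proof. by rewrite /entry !mxE. Qed.

Lemma entry1 a b : entry (1%:M : op C I) a b = (a == b)%:R.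
Proof. by rewrite /entry mxE (inj_eq enum_rank_inj). Qed.

Lemma entryZ k X a b : entry (k *: X : op C I) a b = k * entry X a b.
Proof. by rewrite /entry mxE. Qed.

Lemma entry_sum (J : Type) (r : seq J) (P : pred J) (X : J -> op C I) a b :
  entry (\sum_(j <- r | P j) X j : 'M_#|I|) a b =
  \sum_(j <- r | P j) entry (X j) a b.
Proof. by rewrite /entry summxE. Qed.

Lemma mxtrace_entry X : \tr X = \sum_a entry X a a.
Proof. by rewrite /mxtrace sum_ord_enum_rank. Qed.

Lemma hilbert_schmidt_entry X Y :
  hilbert_schmidt X Y = \sum_a \sum_b (entry X a b)^* * entry Y a b.
Proof.
rewrite /hilbert_schmidt mxtrace_entry exchange_big /=; apply: eq_bigr => b _.
by rewrite entryM; apply: eq_bigr => a _; rewrite entry_adj.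
Qed.

Lemma hilbert_schmidtZ k l X Y :
  hilbert_schmidt (k *: X : op C I) (l *: Y : op C I) =
  k^* * l * hilbert_schmidt X Y.
Proof.
rewrite !hilbert_schmidt_entry mulr_sumr; apply: eq_bigr => a _.
rewrite mulr_sumr; apply: eq_bigr => b _.
by rewrite !entryZ rmorphM mulrACA.
Qed.

Lemma hilbert_schmidtZr l X Y :
  hilbert_schmidt X (l *: Y : op C I) = l * hilbert_schmidt X Y.
Proof. by rewrite /hilbert_schmidt -scalemxAr mxtraceZ. Qed.

Lemma hilbert_schmidt_sumr (J : Type) (r : seq J) (P : pred J)
    (Y : J -> op C I) X :
  hilbert_schmidt X (\sum_(j <- r | P j) Y j : 'M_#|I|) =
  \sum_(j <- r | P j) hilbert_schmidt X (Y j).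
Proof. by rewrite /hilbert_schmidt mulmx_sumr raddf_sum. Qed.

Lemma hilbert_schmidt_suml (J : Type) (r : seq J) (P : pred J)
    (X : J -> op C I) Y :
  hilbert_schmidt (\sum_(j <- r | P j) X j : 'M_#|I|) Y =
  \sum_(j <- r | P j) hilbert_schmidt (X j) Y.
Proof.
rewrite /hilbert_schmidt -raddf_sum -mulmx_suml; congr (\tr (_ *m _)).
by rewrite linear_sum map_mx_sum.
Qed.

(** The coefficient functional [hilbert_schmidt _ X] of an operator X that
    commutes with the unitary P only sees operators up to conjugation by P. *)
Lemma hilbert_schmidt_intertwined (P X Y Z : op C I) (c : C) :
  P \is unitarymx -> X *m P = P *m X -> P *m Y = c *: (Z *m P) ->
  hilbert_schmidt Y X = c^* * hilbert_schmidt Z X.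
Proof.
move=> Pu XP PY.
have PtP : P^t* *m P = 1%:M by apply/mulmx1C/unitarymxP.
have -> : Y = c *: (P^t* *m Z *m P).
  by rewrite -[LHS]mul1mx -PtP -mulmxA PY -scalemxAr mulmxA.
rewrite /hilbert_schmidt adjointZ -scalemxAl mxtraceZ; congr (_ * _).
rewrite !adjointM trmxCK -!mulmxA -XP mxtrace_mulC -!mulmxA.
by rewrite (unitarymxP Pu) mulmx1 mxtrace_mulC.
Qed.

End Operators.

Section Tensor.
Variables (C : numClosedFieldType) (I : finType) (t : nat).
Implicit Types (X Y : 'I_t -> op C I).

Lemma entry_tensor X (a b : {ffun 'I_t -> I}) :
  entry (tensor X) a b = \prod_k entry (X k) (a k) (b k).
Proof. exact: entry_op_of. Qed.

Lemma tensorM X Y :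
  tensor X *m tensor Y = tensor (fun k => X k *m Y k : op C I).
Proof.
apply: opP => a b; rewrite entryM entry_tensor.
under [RHS]eq_bigr do rewrite entryM.
rewrite bigA_distr_bigA; apply: eq_bigr => c _.
by rewrite !entry_tensor big_split.
Qed.

Lemma tensorZ (c : 'I_t -> C) X :
  tensor (fun k => c k *: X k : op C I) = (\prod_k c k) *: tensor X.
Proof.
apply: opP => a b; rewrite entryZ !entry_tensor -big_split.
by apply: eq_bigr => k _; rewrite entryZ.
Qed.

Lemma tensor_adj X : (tensor X)^t* = tensor (fun k => (X k)^t* : op C I).
Proof.
apply: opP => a b; rewrite entry_adj !entry_tensor rmorph_prod.
by apply: eq_bigr => k _; rewrite entry_adj.
Qed.

Lemma tensor1 : tensor (fun _ : 'I_t => 1%:M : op C I) = 1%:M.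
Proof.
apply: opP => a b; rewrite entry_tensor entry1.
under eq_bigr do rewrite entry1.
have [->|neq] := eqVneq a b; first by rewrite big1 // => k _; rewrite eqxx.
have [k neqk] := ffun_neq neq.
by rewrite (bigD1 k) //= (negPf neqk) mul0r.
Qed.

Lemma tensor_unitary X :
  (forall k, X k \is unitarymx) -> tensor X \is unitarymx.
Proof.
move=> Xu; apply/unitarymxP; rewrite tensor_adj tensorM -tensor1.
by congr tensor; apply: funext => k; apply/unitarymxP.
Qed.

Lemma hilbert_schmidt_tensor X Y :
  hilbert_schmidt (tensor X) (tensor Y) = \prod_k hilbert_schmidt (X k) (Y k).
Proof.
rewrite /hilbert_schmidt tensor_adj tensorM mxtrace_entry.
under [RHS]eq_bigr do rewrite mxtrace_entry.
by rewrite bigA_distr_bigA; apply: eq_bigr => a _; rewrite entry_tensor.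
Qed.

End Tensor.

(** * Joint eigenvectors of commuting unitaries *)

Section JointEigenvector.
Variables (C : numClosedFieldType) (n : nat).

(** Commuting matrices are simultaneously triangularised by a unitary P, and
    the rows of P are orthonormal.  For the adjoints of the given matrices the
    first row of P is a left eigenvector, whose adjoint is the vector sought. *)
Lemma joint_eigenvector (J : finType) (X : J -> 'M[C]_n) : (0 < n)%N ->
    (forall j, X j \is unitarymx) ->
    (forall j k, X j *m X k = X k *m X j) ->
  exists (e : 'cV[C]_n) (s : J -> C), e^t* *m e = 1%:M /\
    forall j, X j *m e = s j *: e /\ `|s j| = 1.
Proof.
case: n X => // m X _ Xu XC.
have [|P Pu /allP Ptrig] :=
    @cotrigonalization C _ [seq (X j)^t* | j : J].
  move=> _ _ /imageP[j _ ->] /imageP[k _ ->].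
  by rewrite /comm_mx -!adjointM XC.
pose e := (row 0 P)^t*.
have ee : e^t* *m e = 1%:M.
  rewrite /e trmxCK; apply/matrixP=> i j; rewrite !ord1 !mxE.
  have /matrixP/(_ 0 0) := unitarymxP Pu; rewrite !mxE => <-.
  by apply: eq_bigr => k _; rewrite !mxE.
have eig j : exists s, X j *m e = s *: e.
  have Xj : (X j)^t* \in [seq (X k)^t* | k : J] by apply/imageP; exists j.
  move: {Ptrig Xj}(Ptrig _ Xj) => /=.
  rewrite /similar_to conjymx // => /is_trig_mxP Xtrig.
  set B := _ *m _ *m _ in Xtrig.
  exists (B 0 0)^*.
  have BP : row 0 P *m (X j)^t* = B 0 0 *: row 0 P.
    have -> : row 0 P *m (X j)^t* = row 0 (B *m P).
      by rewrite -row_mul /B -mulmxA (mulmx1C (unitarymxP Pu)) mulmx1.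
    rewrite row_mul; apply/rowP=> k; rewrite !mxE big_ord_recl /= big1.
      by rewrite addr0 !mxE.
    by move=> i _; rewrite mxE Xtrig ?mul0r.
  have := congr1 (fun M : 'rV_m.+1 => M^t*) BP.
  by rewrite /= adjointM trmxCK adjointZ.
have [s sP] := choice eig; exists e, s; split=> // j; split; first exact: sP.
have : (X j *m e)^t* *m (X j *m e) = 1%:M.
  rewrite adjointM -mulmxA [_ *m (X j *m e)]mulmxA.
  by rewrite (mulmx1C (unitarymxP (Xu j))) mul1mx.
rewrite sP adjointZ -scalemxAl -scalemxAr ee scalerA -normCKC.
move=> /matrixP/(_ 0 0); rewrite !mxE mulr1 => /eqP.
by rewrite sqrp_eq1 // => /eqP.
Qed.

End JointEigenvector.

(** * Weyl operators and the orthogonality of characters *)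

Section Weyl.
Variables (C : numClosedFieldType) (A : finZmodType).
Local Notation V := (phase_space C A).
Implicit Types (u v w : V) (a b : A) (chi psi : character C A).

Lemma card_zmod_gt0 : (0 < #|A|)%N.
Proof. by apply/card_gt0P; exists 0. Qed.

Lemma mulr_conj_norm1 (z : C) : `|z| = 1 -> z * z^* = 1.
Proof. by rewrite -normCK => ->; rewrite expr1n. Qed.

Lemma charB chi a b : chi (a - b) = chi a * (chi b)^*.
Proof.
apply: (mulIf (char_neq0 chi b)); rewrite -charD subrK -mulrA [_^* * _]mulrC.
by rewrite mulr_conj_norm1 ?norm_char // mulr1.
Qed.

Lemma character0 a : (0 : character C A) a = 1.
Proof. by rewrite ffunE. Qed.

Lemma characterD chi psi a : (chi + psi) a = chi a * psi a.
Proof. by rewrite ffunE. Qed.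

Lemma betaDl u v w : beta (u + v) w = beta u w * beta v w.
Proof. exact: characterD. Qed.

Lemma betaDr u v w : beta u (v + w) = beta u v * beta u w.
Proof. exact: charD. Qed.

Lemma beta0l v : beta 0 v = 1.
Proof. exact: character0. Qed.

Lemma norm_beta u v : `|beta u v| = 1.
Proof. exact: norm_char. Qed.

Lemma beta_neq0 u v : beta u v != 0.
Proof. exact: char_neq0. Qed.

Lemma beta_suml (J : Type) (r : seq J) (P : pred J) (F : J -> V) w :
  beta (\sum_(j <- r | P j) F j) w = \prod_(j <- r | P j) beta (F j) w.
Proof.
exact: (big_morph (fun u => beta u w) (fun u v => betaDl u v w) (beta0l w)).
Qed.

Lemma omegaDr u v w : omega u (v + w) = omega u v * omega u w.
Proof. by rewrite /omega betaDr betaDl invfM mulrACA. Qed.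

Lemma omega0r u : omega u 0 = 1.
Proof. by rewrite /omega beta0l invr1 mulr1; apply: char0. Qed.

Lemma omega_sumr (J : Type) (r : seq J) (P : pred J) (F : J -> V) w :
  omega w (\sum_(j <- r | P j) F j) = \prod_(j <- r | P j) omega w (F j).
Proof. exact: (big_morph (omega w) (omegaDr w) (omega0r w)). Qed.

Lemma norm_omega u v : `|omega u v| = 1.
Proof. by rewrite normrM normfV !norm_beta invr1 mulr1. Qed.

Lemma entry_weyl v a b :
  entry (weyl v) a b = if a == v.1 + b then v.2 b else 0.
Proof. exact: entry_op_of. Qed.

Lemma weylM u v : weyl u *m weyl v = beta u v *: weyl (u + v).
Proof.
apply: opP => a b; rewrite entryM entryZ (bigD1 (v.1 + b)) //= big1 => [|c neq].
  rewrite !entry_weyl eqxx addr0 addrA /=; case: eqP => _; last first.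
    by rewrite mul0r mulr0.
  by rewrite charD /beta characterD mulrA.
by rewrite !entry_weyl (negPf neq) mulr0.
Qed.

Lemma weyl0 : weyl 0 = 1%:M :> op C A.
Proof.
by apply: opP => a b; rewrite entry_weyl entry1 add0r character0; case: eqP.
Qed.

Lemma weyl_commute u v : weyl u *m weyl v = omega u v *: (weyl v *m weyl u).
Proof.
by rewrite !weylM scalerA /omega mulfVK ?beta_neq0 // addrC.
Qed.

Lemma weyl_unitary v : weyl v \is unitarymx.
Proof.
apply/unitarymxP/(@opP _ A) => a b; rewrite entryM entry1.
rewrite (bigD1 (a - v.1)) //= big1 => [|c neq].
  rewrite entry_adj !entry_weyl [v.1 + _]addrC subrK eqxx addr0.
  rewrite [b == _]eq_sym; case: eqP => [->|]; last by rewrite conjC0 mulr0.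
  by rewrite mulr_conj_norm1 ?norm_char.
rewrite entry_weyl ifN ?mul0r //; apply: contra neq => /eqP->.
by rewrite addrC addKr.
Qed.

(** The trace of the regular representation vanishes off 0.  Triangularising
    the commuting translations writes it as a sum of characters, so these
    cannot all be trivial at a nonzero point. *)
Lemma char_separates a : (forall chi, chi a = 1) -> a = 0.
Proof.
move=> chi1.
pose L b : op C A := weyl ((b, 0) : V).
have LD b c : L b *m L c = L (b + c).
  rewrite /L weylM /beta character0 scale1r; congr weyl.
  by apply: injective_projections => //=; rewrite addr0.
have [|P Pu /allP Ptrig] := @cotrigonalization C _ [seq L b | b : A].
  by move=> _ _ /imageP[b _ ->] /imageP[c _ ->]; rewrite /comm_mx !LD addrC.
pose T b := P *m L b *m P^t*.
have PtP : P^t* *m P = 1%:M by apply/mulmx1C/unitarymxP.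
have TD b c : T (b + c) = T b *m T c.
  by rewrite /T -LD !mulmxA -[_ *m P^t* *m P]mulmxA PtP mulmx1.
have Ttrig b (i j : 'I_#|A|) : (i < j)%N -> T b i j = 0.
  have Lb : L b \in [seq L c | c : A] by apply/imageP; exists b.
  move: {Ptrig Lb}(Ptrig _ Lb) => /=; rewrite /similar_to conjymx //.
  by move/is_trig_mxP; apply.
have diagD b c k : T (b + c) k k = T b k k * T c k k.
  rewrite TD mxE (bigD1 k) //= big1 ?addr0 // => j neq.
  case: (ltngtP k j) => [lt|lt|/val_inj eqkj]; first by rewrite Ttrig ?mul0r.
    by rewrite [T c j k]Ttrig ?mulr0.
  by rewrite eqkj eqxx in neq.
have diag0 k : T 0 k k = 1.
  by rewrite /T /L weyl0 mulmx1 (unitarymxP Pu) mxE eqxx.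
have diagX b k n : T (b *+ n) k k = T b k k ^+ n.
  by elim: n => [|n IH]; rewrite ?diag0 // mulrS diagD IH exprS.
have norm_diag b k : `|T b k k| = 1.
  have : T b k k ^+ #|A| = 1.
    rewrite -diagX; have := expg_cardG (in_setT b).
    by rewrite cardsT FinRing.zmodXgE => ->; apply: diag0.
  move/(congr1 (fun z => `|z|)); rewrite normrX normr1 => /eqP.
  by rewrite pexpr_eq1 ?card_zmod_gt0 // => /eqP.
have char_diag k : is_character [ffun b => T b k k].
  apply/andP; split; apply/forallP=> b; first by rewrite ffunE norm_diag.
  by apply/forallP=> c; rewrite !ffunE diagD.
apply: contraTeq (card_zmod_gt0) => a0.
(* If all characters were 1 at a, then T a would have trace #|A|; but a
   nonzero translation has no fixed point. *)
have : \tr (T a) = 0.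
  rewrite /T mxtrace_mulC mulmxA PtP mul1mx mxtrace_entry big1 // => b _.
  rewrite entry_weyl -[X in X == _]add0r eq_sym (inj_eq (addIr b)).
  by rewrite (negPf a0).
rewrite /mxtrace (eq_bigr (fun=> 1)) => [/eqP|k _]; last first.
  by have := chi1 (Character (char_diag k)); rewrite ffunE.
by rewrite sumr_const card_ord pnatr_eq0 => /eqP->.
Qed.

(** Translating the argument multiplies the sum by a value of chi other than 1.
    The dual sum is treated alike; [char_separates] supplies the factor. *)
Lemma sum_char chi : \sum_a chi a = #|A|%:R * (chi == 0)%:R.
Proof.
have [->|chi0] := eqVneq chi 0.
  by under eq_bigr do rewrite character0; rewrite sumr_const mulr1.
have [b chib] : exists b, chi b != 1.
  apply/existsP; apply: contra_neqT chi0 => /existsPn triv.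
  apply: Defs.charP => b; rewrite character0; apply/eqP.
  by rewrite -[_ == _]negbK.
rewrite mulr0; apply/eqP; rewrite -(mulrI_eq0 _ (mulfI (_ : chi b - 1 != 0))).
  rewrite mulrBl mul1r mulr_sumr subr_eq0; apply/eqP.
  rewrite [RHS](reindex_inj (addrI b)); apply: eq_bigr => a _.
  by rewrite charD.
by rewrite subr_eq0.
Qed.

Lemma sum_char_dual a :
  \sum_(chi : character C A) chi a = #|{: character C A}|%:R * (a == 0)%:R.
Proof.
have [->|a0] := eqVneq a 0.
  by under eq_bigr do rewrite char0; rewrite sumr_const mulr1.
have [psi psia] : exists psi : character C A, psi a != 1.
  apply/existsP; apply: contra_neqT a0 => /existsPn triv.
  by apply: char_separates => chi; apply/eqP; rewrite -[_ == _]negbK.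
rewrite mulr0; apply/eqP; rewrite -(mulrI_eq0 _ (mulfI (_ : psi a - 1 != 0))).
  rewrite mulrBl mul1r mulr_sumr subr_eq0; apply/eqP.
  rewrite [RHS](reindex_inj (addrI psi)); apply: eq_bigr => chi _.
  by rewrite characterD.
by rewrite subr_eq0.
Qed.

Lemma omega_nondegenerate v : (forall w, omega w v = 1) -> v = 0.
Proof.
move=> om1; suff [v1 v2] : v.1 = 0 /\ v.2 = 0.
  by rewrite [v]surjective_pairing v1 v2.
split.
  apply: char_separates => chi; have := om1 ((0, chi) : V).
  by rewrite /omega /beta char0 invr1 mulr1.
apply: Defs.charP => a; have := om1 ((a, 0) : V).
rewrite /omega /beta character0 mul1r => /(congr1 GRing.inv).
by rewrite invrK invr1 character0.
Qed.

Lemma hilbert_schmidt_weyl v w :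
  hilbert_schmidt (weyl v) (weyl w) = #|A|%:R * (v == w)%:R.
Proof.
rewrite hilbert_schmidt_entry exchange_big /=.
have [eq1|neq1] := eqVneq v.1 w.1; last first.
  have -> : (v == w) = false by apply: contraNF neq1 => /eqP->.
  rewrite mulr0 big1 // => b _; rewrite big1 // => a _; rewrite !entry_weyl.
  case: eqP => [->|]; last by rewrite conjC0 mul0r.
  by rewrite (inj_eq (addIr b)) (negPf neq1) mulr0.
have -> : (v == w) = (w.2 - v.2 == 0).
  by rewrite subr_eq0 -pair_eqE /= eq1 eqxx eq_sym.
rewrite -sum_char; apply: eq_bigr => b _.
rewrite (bigD1 (v.1 + b)) //= big1 => [|a neq]; rewrite !entry_weyl.
  rewrite eq1 eqxx addr0 !ffunE mulrC; congr (_ * _).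
  by rewrite invC_norm norm_char expr1n invr1 mul1r.
by rewrite (negPf neq) conjC0 mul0r.
Qed.

(** Completeness, dual to [hilbert_schmidt_weyl]: the Weyl operators resolve
    the matrix units. *)
Lemma weyl_completeness (a b c d : A) :
  \sum_v entry (weyl v : op C A) a b * (entry (weyl v) c d)^* =
  #|{: character C A}|%:R * ((a == c) && (b == d))%:R.
Proof.
transitivity (\sum_x \sum_(chi : character C A)
    entry (weyl ((x, chi) : V)) a b * (entry (weyl ((x, chi) : V)) c d)^*).
  rewrite pair_big; apply: eq_bigr => v _; by rewrite -surjective_pairing.
rewrite (bigD1 (a - b)) //= [X in _ + X]big1 => [|x neq]; last first.
  rewrite big1 // => chi _; rewrite entry_weyl /= ifN ?mul0r //.
  by apply: contra neq => /eqP->; rewrite addrK.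
have [eqc|neqc] := eqVneq c (a - b + d); last first.
  rewrite big1 => [|chi _].
    rewrite addr0; case: andP neqc => [[/eqP-> /eqP->]|]; last by rewrite mulr0.
    by rewrite subrK eqxx.
  by rewrite [entry _ c d]entry_weyl /= (negPf neqc) conjC0 mulr0.
have -> : (a == c) && (b == d) = (b - d == 0).
  by rewrite eqc -[X in X == _](subrK b a) (inj_eq (addrI _)) subr_eq0 andbb.
rewrite addr0 -sum_char_dual; apply: eq_bigr => chi _.
by rewrite !entry_weyl /= subrK eqc !eqxx charB.
Qed.

End Weyl.

(** * Clifford operators and the symplectic group *)

Section Clifford.
Variables (C : numClosedFieldType) (A : finZmodType).
Local Notation V := (phase_space C A).
Implicit Types (u v w : V) (U : op C A) (T : {perm V}).

Lemma scale_weyl_inj (k l : C) v w :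
  k != 0 -> k *: weyl v = l *: weyl w -> v = w.
Proof.
move=> k0 /(congr1 (hilbert_schmidt (1 *: weyl v : op C A))).
rewrite !hilbert_schmidtZ !hilbert_schmidt_weyl conjC1 !mul1r eqxx mulr1.
case: eqP => // _ /eqP; rewrite !mulr0 mulf_eq0 (negPf k0) pnatr_eq0.
by rewrite eqn0Ngt card_zmod_gt0.
Qed.

Lemma Sp_group_set : group_set (Sp C A).
Proof.
apply/group_setP; split=> [|S T].
  rewrite inE group1; apply/forallP=> u; apply/forallP=> v.
  by rewrite !perm1.
case/setIdP=> AS /forallP oS /setIdP[AT /forallP oT].
apply/setIdP; split; first exact: groupM.
apply/forallP=> u; apply/forallP=> v; rewrite !permM.
by rewrite (eqP (forallP (oT _) _)) (eqP (forallP (oS _) _)).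
Qed.

Canonical Sp_group := Group Sp_group_set.

Lemma SpP T :
  reflect ((forall u v, T (u + v) = T u + T v) /\
           (forall u v, omega (T u) (T v) = omega u v))
          (T \in Sp C A).
Proof.
rewrite inE; apply: (iffP andP).
  move=> [/Aut_morphic/morphicP TD /forallP om].
  split=> [u v|u v]; last exact/eqP/(forallP (om u)).
  by have := TD u v (in_setT _) (in_setT _); rewrite !FinRing.zmodMgE.
move=> [TD om]; split.
  2: by apply/forallP=> u; apply/forallP=> v; apply/eqP.
rewrite inE; apply/andP; split; first by apply/subsetP=> u; rewrite in_setT.
by apply/morphicP=> u v _ _; rewrite !FinRing.zmodMgE.
Qed.

Lemma Sp0 T : T \in Sp C A -> T 0 = 0.
Proof. by case/SpP=> TD _; apply: (addrI (T 0)); rewrite -TD !addr0. Qed.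

Lemma Sp_sum T (J : Type) (r : seq J) (P : pred J) (F : J -> V) :
  T \in Sp C A ->
  T (\sum_(j <- r | P j) F j) = \sum_(j <- r | P j) T (F j).
Proof.
by move=> ST; case/SpP: (ST) => TD _; apply: (big_morph T TD (Sp0 ST)).
Qed.

(** The action of U by conjugation, written as an intertwining relation so that
    it passes to tensor powers factor by factor.  When U is unitary, T is
    automatically injective, additive and compatible with omega. *)
Definition implements U (T : V -> V) (lam : V -> C) : Prop :=
  forall v, `|lam v| = 1 /\ U *m weyl v = lam v *: (weyl (T v) *m U).

Lemma unitary_mulmxI U :
  U \is unitarymx -> injective (fun X : op C A => U *m X).
Proof.
move=> Uu X Y /(congr1 (mulmx (U^t*))).
by rewrite !mulmxA (mulmx1C (unitarymxP Uu)) !mul1mx.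
Qed.

Lemma unitary_mulImx U :
  U \is unitarymx -> injective (fun X : op C A => X *m U).
Proof.
move=> Uu X Y /(congr1 (mulmx^~ (U^t*))).
by rewrite -!mulmxA (unitarymxP Uu) !mulmx1.
Qed.

Section Implements.
Variables (U : op C A) (T : V -> V) (lam : V -> C).
Hypotheses (Uu : U \is unitarymx) (UT : implements U T lam).

Lemma implements_phase_neq0 v : lam v != 0.
Proof. by rewrite -normr_eq0 (UT v).1 oner_eq0. Qed.

(** Associativity: U is moved across [weyl u *m weyl v] at one go, or across one
    factor at a time.  Comparing the vectors shows that T is additive, comparing
    the scalars gives the cocycle identity for lam. *)
Lemma implements_weylM u v :
  (beta u v * lam (u + v)) *: weyl (T (u + v)) =
  (lam u * lam v * beta (T u) (T v)) *: weyl (T u + T v).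
Proof.
apply: (unitary_mulImx Uu) => /=; rewrite -!scalemxAl.
transitivity (U *m (weyl u *m weyl v)).
  by rewrite weylM -scalemxAr (UT _).2 scalerA.
rewrite mulmxA (UT u).2 -scalemxAl -mulmxA (UT v).2 -scalemxAr mulmxA weylM.
by rewrite -scalemxAl !scalerA mulrA.
Qed.

Lemma implementsD u v : T (u + v) = T u + T v.
Proof.
apply: (scale_weyl_inj _ (implements_weylM u v)).
by rewrite mulf_neq0 ?beta_neq0 ?implements_phase_neq0.
Qed.

Lemma implements_cocycle u v :
  beta u v * lam (u + v) = lam u * lam v * beta (T u) (T v).
Proof.
have := implements_weylM u v; rewrite implementsD => /eqP.
rewrite -subr_eq0 -scalerBl scaler_eq0 subr_eq0 => /orP[/eqP //|/eqP W0].
have := unitarymxP (weyl_unitary (T u + T v)); rewrite W0 mul0mx.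
move/(congr1 mxtrace)/esym/eqP; rewrite mxtrace0 mxtrace1 pnatr_eq0.
by rewrite eqn0Ngt card_zmod_gt0.
Qed.

(** The cocycle identity has the same phases for (u, v) and for (v, u), so they
    cancel in the quotient that defines omega. *)
Lemma implements_omega u v : omega (T u) (T v) = omega u v.
Proof.
rewrite /omega; apply/eqP; rewrite eqr_div ?beta_neq0 //; apply/eqP.
have nz : lam u * lam v * lam (u + v) != 0.
  by rewrite !mulf_neq0 ?implements_phase_neq0.
apply: (mulfI nz).
have uv := implements_cocycle u v; have vu := implements_cocycle v u.
rewrite [v + u]addrC in vu.
transitivity (lam u * lam v * beta (T u) (T v) * (beta v u * lam (u + v))).
  by ring.
by rewrite -uv vu; ring.
Qed.

Lemma implements_inj : injective T.
Proof.
move=> u v eqT; apply: (@scale_weyl_inj (lam v) (lam u)).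
  exact: implements_phase_neq0.
apply: (unitary_mulmxI Uu) => /=.
by rewrite -!scalemxAr (UT u).2 (UT v).2 eqT !scalerA mulrC.
Qed.

End Implements.

Lemma implements_Sp U T lam :
  U \is unitarymx -> implements U T lam -> T \in Sp C A.
Proof.
move=> Uu UT; apply/SpP; split=> u v.
  exact: implementsD Uu UT u v.
exact: implements_omega Uu UT u v.
Qed.

(** The bijectivity of T makes every Weyl operator a conjugate of one, which is
    the half of the normaliser condition that the intertwining does not show. *)
Lemma implements_normalizes U T lam :
  U \is unitarymx -> implements U T lam -> normalizes_heisenberg U.
Proof.
move=> Uu UT; split=> // M.
have conjU v : U *m weyl v *m invmx U = lam v *: weyl (T v).
  by rewrite (UT v).2 -scalemxAl mulmxK // unitarymx_unit.
split=> [[z [w [z1 ->]]]|[_ [[z [v [z1 ->]] ->]]]]; last first.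
  exists (z * lam v), (T v); rewrite normrM z1 (UT v).1 mulr1; split=> //.
  by rewrite -scalemxAr -scalemxAl conjU scalerA.
pose v := (T^-1)%g w; exists ((z / lam v) *: weyl v); split.
  by exists (z / lam v), v; rewrite normrM normfV z1 (UT v).1 invr1 mulr1.
rewrite -scalemxAr -scalemxAl conjU scalerA mulfVK ?permKV //.
exact: implements_phase_neq0 UT v.
Qed.

Lemma normalizes_implements U : normalizes_heisenberg U ->
  exists (T : {perm V}) (lam : V -> C), T \in Sp C A /\ implements U T lam.
Proof.
case=> Uu normU.
have ex v : exists zw : C * V,
    `|zw.1| = 1 /\ U *m weyl v = zw.1 *: (weyl zw.2 *m U).
  have [|z [w [z1 eqz]]] := (normU (U *m weyl v *m invmx U)).2.
    by exists (weyl v); split=> //; exists 1, v; rewrite normr1 scale1r.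
  by exists (z, w); split=> //=; rewrite scalemxAl -eqz mulmxKV ?unitarymx_unit.
have [f fP] := choice ex; pose lam v := (f v).1; pose T0 v := (f v).2.
have UT0 : implements U T0 lam by [].
pose T := perm (implements_inj Uu UT0).
have UT : implements U T lam by move=> v; rewrite /T permE.
by exists T, lam; split=> //; apply: implements_Sp UT.
Qed.

Lemma weyl_implements w : implements (weyl w) (1%g : {perm V}) (omega w).
Proof.
by move=> v; rewrite norm_omega perm1; split=> //; apply: weyl_commute.
Qed.

End Clifford.

Section Realisation.
Variables (C : numClosedFieldType) (A : finZmodType).
Local Notation V := (phase_space C A).

Lemma col_weyl (v : V) (b : A) :
  col (enum_rank b) (weyl v) = v.2 b *: delta_mx (enum_rank (v.1 + b)) 0.
Proof.
apply/colP=> i.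
rewrite mxE [RHS]mxE [delta_mx _ _ _ _]mxE eqxx andbT.
rewrite -{1}(enum_valK i) [LHS]entry_weyl -(inj_eq enum_rank_inj) enum_valK.
by case: eqP => _; rewrite ?mulr1 ?mulr0.
Qed.

(** Every symplectic map T is realised by a unitary.  The operators
    [weyl (T (a, 0))] commute, and so do the operators [weyl (T (0, chi))].
    The eigenvalues [s a] of a joint eigenvector of the former turn
    [(s a)^-1 *: weyl (T (a, 0))] into a true representation of A, in which the
    cocycle [beta] has disappeared; applied to a joint eigenvector e of the
    latter, it gives an orthonormal basis that plays for T the part of the
    basis [|a>]. *)
Lemma Sp_implemented (T : {perm V}) : T \in Sp C A ->
  exists (U : op C A) (lam : V -> C), U \is unitarymx /\ implements U T lam.
Proof.
case/SpP=> TD Tom.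
pose X (a : A) := weyl (T ((a, 0) : V)).
pose Z (chi : character C A) := weyl (T ((0, chi) : V)).
have pairD (a b : A) (chi psi : character C A) :
    ((a, chi) : V) + (b, psi) = (a + b, chi + psi) by [].
have XX a b : X a *m X b = X b *m X a.
  rewrite /X weyl_commute Tom /omega /beta /= !character0 invr1 mulr1.
  by rewrite scale1r.
have ZZ chi psi : Z chi *m Z psi = Z psi *m Z chi.
  by rewrite /Z weyl_commute Tom /omega /beta /= !char0 invr1 mulr1 scale1r.
have ZX chi b : Z chi *m X b = chi b *: (X b *m Z chi).
  by rewrite /Z /X weyl_commute Tom /omega /beta /= ffunE invr1 mulr1.
have Xu a : X a \is unitarymx by apply: weyl_unitary.
have Zu chi : Z chi \is unitarymx by apply: weyl_unitary.
have [f [s [ff fP]]] := joint_eigenvector (card_zmod_gt0 A) Xu XX.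
have [e [mu [ee eP]]] := joint_eigenvector (card_zmod_gt0 A) Zu ZZ.
have s0 a : s a != 0 by rewrite -normr_eq0 (fP a).2 oner_eq0.
have XM a b : X a *m X b = (s a * s b / s (a + b)) *: X (a + b).
  have XMb : X a *m X b = beta (T (a, 0)) (T (b, 0)) *: X (a + b).
    by rewrite /X weylM -TD pairD addr0.
  rewrite XMb; congr (_ *: _); apply/eqP.
  rewrite eq_sym -(inj_eq (mulIf (s0 (a + b)))) mulfVK //; apply/eqP.
  have : X a *m X b *m f = (s a * s b) *: f.
    by rewrite -mulmxA (fP b).1 -scalemxAr (fP a).1 scalerA mulrC.
  rewrite XMb -scalemxAl (fP _).1 scalerA.
  move/(congr1 (mulmx (f^t*))); rewrite -!scalemxAr ff.
  by move/matrixP/(_ 0 0); rewrite !mxE !mulr1 => <-.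
pose g b := (s b)^-1 *: (X b *m e).
have Xg a b : X a *m g b = s a *: g (a + b).
  rewrite /g -scalemxAr mulmxA XM -scalemxAl !scalerA; congr (_ *: _).
  by field; rewrite !s0.
have Zg chi b : Z chi *m g b = (chi b * mu chi) *: g b.
  rewrite /g -scalemxAr mulmxA ZX -scalemxAl -mulmxA (eP chi).1 -scalemxAr.
  by rewrite !scalerA; congr (_ *: _); ring.
have gg b : (g b)^t* *m g b = 1%:M.
  rewrite /g adjointZ -scalemxAl -scalemxAr scalerA adjointM -mulmxA.
  rewrite [_ *m (X b *m e)]mulmxA (mulmx1C (unitarymxP (Xu b))) mul1mx ee.
  by rewrite mulrC mulr_conj_norm1 ?scale1r // normfV (fP b).2 invr1.
have gort a b : a != b -> (g a)^t* *m g b = 0.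
  move=> neq.
  have [chi chiab] : exists chi : character C A, chi (b - a) != 1.
    apply/existsP; apply: contraNT neq => /existsPn triv.
    rewrite eq_sym -subr_eq0; apply/eqP/(@char_separates C) => chi; apply/eqP.
    by have := triv chi; rewrite negbK.
  have : (Z chi *m g a)^t* *m (Z chi *m g b) = (g a)^t* *m g b.
    rewrite adjointM -mulmxA [_ *m (Z chi *m g b)]mulmxA.
    by rewrite (mulmx1C (unitarymxP (Zu chi))) mul1mx.
  rewrite !Zg adjointZ -scalemxAl -scalemxAr scalerA.
  set D := _ *m _; move/eqP; rewrite -subr_eq0 -[X in _ - X]scale1r -scalerBl.
  rewrite scaler_eq0 => /orP[|/eqP //]; rewrite subr_eq0 => /eqP chi1.
  case/eqP: chiab; rewrite charB -chi1 rmorphM /=.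
  have := mulr_conj_norm1 (eP chi).2 => mu1.
  by rewrite -[LHS]mulr1 -mu1; ring.
pose U : op C A := \matrix_(i, j) g (enum_val j) i 0.
have colU b : U *m delta_mx (enum_rank b) 0 = g b.
  by rewrite -colE; apply/colP=> i; rewrite !mxE enum_rankK.
have Uu : U \is unitarymx.
  apply/unitarymxP/mulmx1C/matrixP=> i j.
  transitivity (((g (enum_val i))^t* *m g (enum_val j)) 0 0).
    by rewrite !mxE; apply: eq_bigr => k _; rewrite !mxE.
  rewrite [RHS]mxE -(inj_eq enum_val_inj); case: eqVneq => [->|neq].
    by rewrite gg mxE.
  by rewrite gort ?mxE.
pose lam (v : V) := beta (T (v.1, 0)) (T (0, v.2)) / (mu v.2 * s v.1).
exists U, lam; split=> // -[a chi]; split.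
  rewrite normrM normfV normrM norm_beta (eP chi).2 (fP a).2.
  by rewrite mulr1 invr1 mulr1.
have WT : X a *m Z chi = beta (T (a, 0)) (T (0, chi)) *: weyl (T (a, chi)).
  by rewrite /X /Z weylM -TD pairD addr0 add0r.
have mu0 : mu chi != 0 by rewrite -normr_eq0 (eP chi).2 oner_eq0.
apply/matrixP=> i j; rewrite -(enum_valK j); move: (enum_val j) => b.
suff /colP/(_ i) : col (enum_rank b) (U *m weyl (a, chi)) =
    col (enum_rank b) (lam (a, chi) *: (weyl (T (a, chi)) *m U)).
  by rewrite ![col _ _ _ _]mxE.
rewrite colE -mulmxA -colE col_weyl -scalemxAr colU /=.
rewrite colE -scalemxAl -mulmxA colU.
have -> : weyl (T (a, chi)) *m g b =
    (beta (T (a, 0)) (T (0, chi)))^-1 *: (X a *m Z chi *m g b).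
  by rewrite WT -scalemxAl scalerA mulVf ?beta_neq0 // scale1r.
rewrite -mulmxA Zg -scalemxAr Xg !scalerA /lam /=; congr (_ *: _).
by field; rewrite !s0 mu0 beta_neq0.
Qed.

End Realisation.

(** * Phases of tuples *)

Section Phases.
Variables (C : numClosedFieldType) (A : finZmodType) (t : nat).
Local Notation V := (phase_space C A).
Local Notation tuples := {ffun 'I_t -> V}.
Implicit Types (U : op C A) (T : {perm V}) (v w : tuples).

Lemma norm_kappa v : `|kappa v| = 1.
Proof.
rewrite /kappa normr_prod big1 // => i _; rewrite normr_prod big1 // => j _.
exact: norm_beta.
Qed.

Lemma kappa_neq0 v : kappa v != 0.
Proof. by rewrite -normr_eq0 norm_kappa oner_eq0. Qed.

(** Bimultiplicativity of beta collects the pairs (i, n), i < n, in a single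
    factor.  The scalar of an ordered product of n + 1 Weyl operators satisfies
    the same recursion. *)
Lemma prod_beta_recr n (F : 'I_n.+1 -> V) :
  \prod_(i < n.+1) \prod_(j < n.+1 | (i < j)%N) beta (F i) (F j) =
  (\prod_(i < n) \prod_(j < n | (i < j)%N)
     beta (F (widen_ord (leqnSn n) i)) (F (widen_ord (leqnSn n) j))) *
  beta (\sum_(i < n) F (widen_ord (leqnSn n) i)) (F ord_max).
Proof.
rewrite big_ord_recr /= [X in _ * X]big1 ?mulr1 => [|j]; last first.
  by rewrite ltnNge -ltnS ltn_ord.
rewrite beta_suml -big_split; apply: eq_bigr => i _.
by rewrite big_mkcond big_ord_recr /= ltn_ord -big_mkcond.
Qed.

Section Implements.
Variables (U : op C A) (T : {perm V}) (lam : V -> C).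
Hypotheses (Uu : U \is unitarymx) (UT : implements U T lam).

Lemma implements_phase0 : lam 0 = 1.
Proof.
have := implements_cocycle Uu UT 0 0.
rewrite (Sp0 (implements_Sp Uu UT)) addr0 !beta0l !mul1r mulr1.
by rewrite -[LHS]mulr1 => /(mulfI (implements_phase_neq0 UT 0)) <-.
Qed.

(** The cocycle identity, telescoped along the partial sums of F. *)
Lemma prod_phase_cocycle n (F : 'I_n -> V) :
  (\prod_i lam (F i)) *
    \prod_(i < n) \prod_(j < n | (i < j)%N) beta (T (F i)) (T (F j)) =
  (\prod_(i < n) \prod_(j < n | (i < j)%N) beta (F i) (F j)) *
    lam (\sum_i F i).
Proof.
elim: n F => [|n IHn] F.
  by rewrite !big_ord0 implements_phase0.
rewrite (prod_beta_recr F) (prod_beta_recr (fun i => T (F i))).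
rewrite !big_ord_recr /= -[RHS]mulrA (implements_cocycle Uu UT).
rewrite -(Sp_sum _ _ _ (implements_Sp Uu UT)) [RHS]mulrA [in RHS]mulrA -IHn.
by ring.
Qed.

Lemma kappa_diag_act v : v \in zero_sum C A t ->
  (\prod_i lam (v i)) * kappa (diag_act v T) = kappa v.
Proof.
rewrite inE => /eqP v0; have := prod_phase_cocycle v.
rewrite v0 implements_phase0 mulr1 /kappa => <-; congr (_ * _).
by apply: eq_bigr => i _; apply: eq_bigr => j _; rewrite !ffunE.
Qed.

Lemma tensor_pow_weyl_tuple v :
  tensor_pow t U *m weyl_tuple v =
  (\prod_i lam (v i)) *: (weyl_tuple (diag_act v T) *m tensor_pow t U).
Proof.
rewrite /tensor_pow /weyl_tuple !tensorM -tensorZ; congr tensor.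
by apply: funext => i; rewrite (UT (v i)).2 ffunE.
Qed.

End Implements.

Lemma hilbert_schmidt_weyl_tuple v w :
  hilbert_schmidt (weyl_tuple v) (weyl_tuple w) =
  (#|A| ^ t)%:R * (v == w)%:R.
Proof.
rewrite hilbert_schmidt_tensor.
under eq_bigr do rewrite hilbert_schmidt_weyl.
rewrite big_split prodr_const card_ord natrX; congr (_ * _).
have [->|neq] := eqVneq v w; first by rewrite big1 // => i _; rewrite eqxx.
have [i vi] := ffun_neq neq.
by rewrite (bigD1 i) //= (negPf vi) mul0r.
Qed.

(** The completeness relation of the Weyl operators, taken in each tensor
    factor, turns the right-hand side into a sum over matrix units. *)
Lemma weyl_tuple_expansion (X : op C {ffun 'I_t -> A}) :
  (#|{: character C A}| ^ t)%:R *: X =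
  \sum_(v : tuples) hilbert_schmidt (weyl_tuple v) X *: weyl_tuple v.
Proof.
apply: opP => a b; rewrite entryZ entry_sum.
have complete p q :
    \sum_(v : tuples) \prod_i
      (entry (weyl (v i)) (a i) (b i) * (entry (weyl (v i)) (p i) (q i))^*) =
    \prod_i (#|{: character C A}|%:R * ((a i == p i) && (b i == q i))%:R).
  rewrite -(bigA_distr_bigA (fun i (x : V) =>
    entry (weyl x) (a i) (b i) * (entry (weyl x) (p i) (q i))^*)).
  by apply: eq_bigr => i _; apply: weyl_completeness.
transitivity (\sum_p \sum_q entry X p q *
    \sum_(v : tuples) \prod_i
      (entry (weyl (v i)) (a i) (b i) * (entry (weyl (v i)) (p i) (q i))^*)).
  rewrite (bigD1 a) //= [X in _ + X]big1 => [|p neq]; last first.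
    have [i pi] := ffun_neq neq; rewrite big1 // => q _.
    by rewrite complete (bigD1 i) //= eq_sym (negPf pi) mulr0 mul0r mulr0.
  rewrite addr0 (bigD1 b) //= [X in _ + X]big1 => [|q neq]; last first.
    have [i qi] := ffun_neq neq; rewrite complete (bigD1 i) //=.
    by rewrite [b i == _]eq_sym (negPf qi) andbF mulr0 mul0r mulr0.
  rewrite addr0 complete mulrC; congr (_ * _).
  under eq_bigr do rewrite !eqxx mulr1.
  by rewrite prodr_const card_ord natrX.
under eq_bigr => p _ do under eq_bigr => q _ do rewrite mulr_sumr.
rewrite pair_big exchange_big; apply: eq_bigr => v _.
rewrite entryZ hilbert_schmidt_entry pair_big mulr_suml.
apply: eq_bigr => -[p q] _ /=.
by rewrite big_split /= -rmorph_prod -!entry_tensor /weyl_tuple; ring.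
Qed.

End Phases.

(** * The commutant *)

Lemma orthogonal_free (C : numClosedFieldType) (I J : finType) (S : {set J})
    (F : J -> op C I) :
  {in S &, forall i j, i != j -> hilbert_schmidt (F i) (F j) = 0} ->
  {in S, forall j, hilbert_schmidt (F j) (F j) != 0} ->
  free ([seq F j | j in S] : seq 'M[C]_#|I|).
Proof.
move=> orth nz; apply/(@freeP _ _ _ (image_tuple F S)) => k sum0 i.
have Si : enum_val i \in S by apply: enum_valP.
apply: (mulIf (nz _ Si)); rewrite mul0r.
transitivity (hilbert_schmidt (F (enum_val i))
    (\sum_j k j *: [seq F j | j in S]`_j)); last first.
  by rewrite sum0 /hilbert_schmidt mulmx0 mxtrace0.
rewrite hilbert_schmidt_sumr (bigD1 i) //= big1 => [|j neq].
  by rewrite addr0 nth_image hilbert_schmidtZr.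
rewrite nth_image hilbert_schmidtZr orth ?mulr0 //.
  exact: enum_valP.
by rewrite (inj_eq enum_val_inj) eq_sym.
Qed.

Section Commutant.
Variables (C : numClosedFieldType) (A : finZmodType) (t : nat).
Local Notation V := (phase_space C A).
Local Notation tuples := {ffun 'I_t -> V}.
Implicit Types (U : op C A) (T : {perm V}) (v w : tuples).
Implicit Types (X : op C {ffun 'I_t -> A}) (o : {set tuples}).

(** A phase in front of U appears to the same power on both sides, so one
    representative of each Clifford class is enough. *)
Lemma in_commutantP X :
  in_commutant X <->
  forall U, normalizes_heisenberg U ->
    X *m tensor_pow t U = tensor_pow t U *m X.
Proof.
split=> [XC U normU | XC g [U [normU gU]] _ /gU[z [_ ->]]].
  apply: (XC (fun M => exists z : C, `|z| = 1 /\ M = z *: U)).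
    by exists U; split.
  by exists 1; rewrite normr1 scale1r.
by rewrite /tensor_pow tensorZ -scalemxAr -scalemxAl -/(tensor_pow t U) XC.
Qed.

Lemma Sp_acts_zero_sum : [acts Sp C A, on zero_sum C A t | diag_action C A t].
Proof.
apply/actsP=> T ST v; rewrite !inE /=.
under eq_bigr do rewrite ffunE.
rewrite -(Sp_sum _ _ _ ST) -[X in _ == X](Sp0 ST).
by rewrite (inj_eq perm_inj).
Qed.

Lemma Sp_orbits_partition : partition (Sp_orbits C A t) (zero_sum C A t).
Proof. exact: (orbit_partition Sp_acts_zero_sum). Qed.

Lemma Sp_orbit_stable o T v : o \in Sp_orbits C A t -> T \in Sp C A ->
  (diag_act v T \in o) = (v \in o).
Proof.
by case/imsetP=> x _ -> ST; apply: (orbit_actr (diag_action C A t) x v ST).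
Qed.

Lemma orbit_op_in_commutant o :
  o \in Sp_orbits C A t -> in_commutant (orbit_op o).
Proof.
move=> oO; apply/in_commutantP=> U normU.
have Uu : U \is unitarymx by case: normU.
have [T [lam [ST UT]]] := normalizes_implements normU.
have sub_o v : v \in o -> v \in zero_sum C A t.
  have /and3P[/eqP <- _ _] := Sp_orbits_partition.
  by move=> vo; apply/bigcupP; exists o.
rewrite /orbit_op mulmx_suml mulmx_sumr.
rewrite (reindex_inj (@act_inj _ _ _ (diag_action C A t) T)) /=.
apply: eq_big => [v|v]; first exact: Sp_orbit_stable.
rewrite (Sp_orbit_stable v oO ST) => vo.
rewrite -scalemxAl -scalemxAr (tensor_pow_weyl_tuple UT) scalerA.
congr (_ *: _); rewrite -(kappa_diag_act Uu UT (sub_o v vo)) invfM mulrAC.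
rewrite mulVf ?mul1r //; apply/prodf_neq0=> i _.
exact: implements_phase_neq0 UT _.
Qed.

Section Coefficients.
Variable X : op C {ffun 'I_t -> A}.
Hypothesis XC : in_commutant X.

(** Commuting with the tensor power of [weyl w] multiplies the coefficient at v
    by the conjugate of omega w (v_1 + ... + v_t). *)
Lemma coef_outside_zero_sum v :
  v \notin zero_sum C A t -> hilbert_schmidt (weyl_tuple v) X = 0.
Proof.
apply: contraNeq => hs0; rewrite inE; apply/eqP.
apply: omega_nondegenerate => w.
have Wu := weyl_unitary w; have WT := @weyl_implements C A w.
have comm := (in_commutantP X).1 XC _ (implements_normalizes Wu WT).
have := hilbert_schmidt_intertwined (tensor_unitary (fun=> Wu)) comm
  (tensor_pow_weyl_tuple WT v).
rewrite -omega_sumr.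
have -> : diag_act v 1%g = v by apply/ffunP=> i; rewrite ffunE perm1.
move=> /eqP; rewrite -[X in X == _]mul1r (inj_eq (mulIf hs0)) => /eqP om1.
by rewrite -[LHS]conjCK -om1 conjC1.
Qed.

(** Moving T through the coefficient functional costs the phases of T, and they
    are compensated by [kappa]. *)
Lemma coef_Sp_invariant v T : T \in Sp C A -> v \in zero_sum C A t ->
  kappa (diag_act v T) * hilbert_schmidt (weyl_tuple (diag_act v T)) X =
  kappa v * hilbert_schmidt (weyl_tuple v) X.
Proof.
move=> ST v0; have [U [lam [Uu UT]]] := Sp_implemented ST.
have comm := (in_commutantP X).1 XC _ (implements_normalizes Uu UT).
rewrite (hilbert_schmidt_intertwined (tensor_unitary (fun=> Uu)) comm
  (tensor_pow_weyl_tuple UT v)) -(kappa_diag_act Uu UT v0).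
rewrite mulrACA mulr_conj_norm1 ?mul1r // normr_prod big1 // => i _.
by rewrite (UT (v i)).1.
Qed.

End Coefficients.

Lemma hilbert_schmidt_orbit_op o1 o2 :
  hilbert_schmidt (orbit_op o1) (orbit_op o2) =
  #|o1 :&: o2|%:R * (#|A| ^ t)%:R.
Proof.
rewrite /orbit_op hilbert_schmidt_suml.
transitivity (\sum_(v in o1 | v \in o2) (#|A| ^ t)%:R : C); last first.
  rewrite (eq_bigl (mem (o1 :&: o2))) => [|v]; last by rewrite !inE.
  by rewrite sumr_const mulr_natl.
rewrite [RHS]big_mkcondr; apply: eq_bigr => v _; rewrite hilbert_schmidt_sumr.
have [vo2|vo2] := ifP; last first.
  rewrite big1 // => w wo2; rewrite hilbert_schmidtZ hilbert_schmidt_weyl_tuple.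
  by case: eqP wo2 => [<-|]; rewrite ?vo2 ?mulr0.
rewrite (bigD1 v) //= big1 => [|w /andP[_ neq]].
  rewrite addr0 hilbert_schmidtZ hilbert_schmidt_weyl_tuple eqxx mulr1.
  by rewrite [_^* * _]mulrC mulr_conj_norm1 ?mul1r // normfV norm_kappa invr1.
rewrite hilbert_schmidtZ hilbert_schmidt_weyl_tuple eq_sym (negPf neq).
by rewrite !mulr0.
Qed.

Lemma orbit_op_orthogonal o1 o2 :
  o1 \in Sp_orbits C A t -> o2 \in Sp_orbits C A t -> o1 != o2 ->
  hilbert_schmidt (orbit_op o1) (orbit_op o2) = 0.
Proof.
move=> O1 O2 neq; rewrite hilbert_schmidt_orbit_op.
have /and3P[_ /trivIsetP/(_ _ _ O1 O2 neq) disj _] := Sp_orbits_partition.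
by rewrite (disjoint_setI0 disj) cards0 mul0r.
Qed.

Lemma orbit_op_free : free [seq orbit_op o | o in Sp_orbits C A t].
Proof.
apply: orthogonal_free => [o1 o2|o oO]; first exact: orbit_op_orthogonal.
rewrite hilbert_schmidt_orbit_op setIid -natrM pnatr_eq0 muln_eq0.
rewrite negb_or -!lt0n expn_gt0 card_zmod_gt0 andbT.
by case/imsetP: oO => v _ ->; apply/card_gt0P; exists v; apply: orbit_refl.
Qed.

Lemma commutant_sub_span X :
  in_commutant X -> X \in <<[seq orbit_op o | o in Sp_orbits C A t]>>%VS.
Proof.
move=> XC; have N0 : (#|{: character C A}| ^ t)%:R != 0 :> C.
  by rewrite pnatr_eq0 -lt0n expn_gt0 card_zmod_gt0.
rewrite -[X]scale1r -(mulVf N0) -scalerA; apply: memvZ.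
rewrite weyl_tuple_expansion (bigID (mem (zero_sum C A t))) /=.
rewrite [X in _ + X]big1 ?addr0; last first.
  by move=> v /(coef_outside_zero_sum XC) ->; rewrite scale0r.
rewrite (set_partition_big _ Sp_orbits_partition); apply: memv_suml => o oO.
have /imsetP[x x0 eqo] := oO.
set y := kappa x * hilbert_schmidt (weyl_tuple x) X.
have -> : \sum_(v in o) hilbert_schmidt (weyl_tuple v) X *: weyl_tuple v =
    y *: orbit_op o.
  rewrite scaler_sumr eqo; apply: eq_bigr => _ /orbitP[T ST <-].
  rewrite scalerA /y -(coef_Sp_invariant XC ST x0) /=.
  by rewrite [_ * hilbert_schmidt _ _]mulrC mulfK ?kappa_neq0.
by apply/memvZ/memv_span/imageP; exists o.
Qed.

Lemma orbit_op_basis :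
  basis_of (commutant C A t) [seq orbit_op o | o in Sp_orbits C A t].
Proof.
rewrite /basis_of orbit_op_free andbT eqEsubv; apply/andP; split.
  apply/span_subvP=> _ /imageP[o oO ->].
  exact/mem_commutant/orbit_op_in_commutant.
by apply/subvP=> X /mem_commutant; apply: commutant_sub_span.
Qed.

End Commutant.

Theorem theorem5p2 (R : realType) (A : finZmodType) (t : nat) (ht : (0 < t)%N) :
  [/\ basis_of (commutant R[i] A t)
        [seq orbit_op o | o in Sp_orbits R[i] A t],
      forall o1 o2, o1 \in Sp_orbits R[i] A t -> o2 \in Sp_orbits R[i] A t ->
        o1 != o2 -> hilbert_schmidt (orbit_op o1) (orbit_op o2) = 0
    & \dim (commutant R[i] A t) = #|Sp_orbits R[i] A t| ].
Proof.
split; [exact: orbit_op_basis | exact: orbit_op_orthogonal |].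
exact: (@size_basis _ _ _ _ (image_tuple _ _) (orbit_op_basis _ _ _)).
Qed.
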